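(* Let $\mathcal{P}$ be a homogeneous Poisson process on $\mathbb{R}^3$ of intensity $1$, and let $d$ denote either the Euclidean metric or the metric induced by the norm $\|(x_1,x_2,t)\|_{JM}=\sqrt{x_1^2+x_2^2}+|t|$. Let $O$ be the origin. For $A>0$ and $k\ge1$ let $E_k=E_{k,A}$ be the event that $\mathcal{P}$ contains $k$ points $P_1,\dots,P_k$ for which there exist points $Q_1,\dots,Q_k\in\mathbb{R}^3$ and real numbers $0<r_1,\dots,r_k<Ak^{1/3}$ such that $d(O,Q_i)=d(P_i,Q_i)=r_i$ for every $i$, and $d(P_j,Q_i)\ge r_i$ for all $i$ and $j$. If $A>0$ and $C>0$ are constants, then $\mathbb{P}(E_k)=o(e^{-Ck})$ as $k\to\infty$. *)

(* Defs.v *)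
From HB Require Import structures.
From mathcomp Require Import all_boot all_order all_algebra.
From mathcomp Require Import all_classical all_reals all_analysis.
Set Implicit Arguments. Unset Strict Implicit. Unset Printing Implicit Defensive.
Import Order.TTheory GRing.Theory Num.Theory.
Import numFieldNormedType.Exports.
Local Open Scope classical_set_scope.
Local Open Scope ring_scope.

(* Points of R^3, written (x1, x2, t) : (R * R) * R, with the product
   (Borel) sigma-algebra. *)
Definition pt (R : realType) := ((R * R) * R)%type.

Definition origin (R : realType) : pt R := (0, 0, 0).

Definition dEucl (R : realType) (p q : pt R) : R :=
  Num.sqrt ((p.1.1 - q.1.1) ^+ 2 + (p.1.2 - q.1.2) ^+ 2 + (p.2 - q.2) ^+ 2).

Definition dJM (R : realType) (p q : pt R) : R :=
  Num.sqrt ((p.1.1 - q.1.1) ^+ 2 + (p.1.2 - q.1.2) ^+ 2) + `|p.2 - q.2|.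

Definition leb3 (R : realType) : set (pt R) -> \bar R :=
  ((@lebesgue_measure R \x @lebesgue_measure R) \x @lebesgue_measure R)%E.

Definition bounded3 (R : realType) (B : set (pt R)) : Prop :=
  exists M : R, forall p, B p -> `|p.1.1| <= M /\ `|p.1.2| <= M /\ `|p.2| <= M.

Definition has_card (T : eqType) (A : set T) (n : nat) : Prop :=
  exists s : seq T, uniq s /\ size s = n /\ A = [set x | x \in s].

Definition count_event (R : realType) (Omega : Type) (X : Omega -> set (pt R))
  (B : set (pt R)) (n : nat) : set Omega :=
  [set w | has_card (X w `&` B) n].

Definition poisson_process_R3 (R : realType) (d : measure_display)
  (Omega : measurableType d) (P : probability Omega R)
  (X : Omega -> set (pt R)) : Prop :=
  [/\ (forall w B, measurable B -> bounded3 B -> finite_set (X w `&` B)),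
      (forall B n, measurable B -> bounded3 B ->
         measurable (count_event X B n) /\
         P (count_event X B n) =
           ((expR (- fine (leb3 B)) * fine (leb3 B) ^+ n / (n`!)%:R)%:E))
    & (forall (m : nat) (B : 'I_m -> set (pt R)) (n : 'I_m -> nat),
         (forall i, measurable (B i) /\ bounded3 (B i)) ->
         (forall i j, i != j -> B i `&` B j = set0) ->
         fine (P (\bigcap_(i in [set: 'I_m]) count_event X (B i) (n i))) =
           \prod_(i < m) fine (P (count_event X (B i) (n i))))].

Definition event_E (R : realType) (Omega : Type) (X : Omega -> set (pt R))
  (dist : pt R -> pt R -> R) (A : R) (k : nat) : set Omega :=
  [set w | exists (Pt : 'I_k -> pt R), injective Pt /\
     (forall i, X w (Pt i)) /\
     exists (Q : 'I_k -> pt R) (r : 'I_k -> R),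
       (forall i, 0 < r i /\ r i < A * (k%:R `^ (3%:R)^-1)) /\
       (forall i, dist (origin R) (Q i) = r i /\ dist (Pt i) (Q i) = r i) /\
       (forall i j, r i <= dist (Pt j) (Q i))].

(* Main.v *)
Require Import Defs.
From HB Require Import structures.
From mathcomp Require Import all_boot all_order all_algebra.
From mathcomp Require Import all_classical all_reals all_analysis.
From mathcomp Require Import ring lra.
Import Order.TTheory GRing.Theory Num.Theory.
Import numFieldNormedType.Exports.
Local Open Scope classical_set_scope.
Local Open Scope ring_scope.

(** A point [p] of the configuration lies, like the origin, on the boundary of
    a ball containing no other configuration point in its interior; the radius
    of that ball is at least half the distance from [p] to the origin.  Hence
    the configuration is porous at every scale: when a cube is divided into
    [32 ^ 3] equal subcubes, at least one of them contains no configuration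
    point.  Iterating [n] times, the configuration, which lives in a cube of
    volume [O(k)], is covered by one of finitely many sets (their number
    depends on [n] only) of volume at most [(1 - 32 ^ -3) ^ n * O(k)].  For [n]
    large this is at most [e k] with [e] as small as we please, and a Poisson
    variable of mean at most [e k] exceeds [k] with probability at most
    [exp (- (C + 1) k)]; a union bound over the finite family concludes. *)

(** * Properties common to the two metrics *)

(** What the geometric argument uses of either metric: comparison with the sup metric on both sides,
    the triangle inequality, and points dividing a segment in any given ratio. It lets one proof
    serve both metrics. *)
Definition norm_metric {R : realType} (dist : pt R -> pt R -> R) : Prop :=
  [/\ forall p q, [/\ `|p.1.1 - q.1.1| <= dist p q,
        `|p.1.2 - q.1.2| <= dist p q & `|p.2 - q.2| <= dist p q],
      forall p q u, `|p.1.1 - q.1.1| <= u -> `|p.1.2 - q.1.2| <= u ->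
        `|p.2 - q.2| <= u -> dist p q <= 3 * u,
      forall p q s, dist p s <= dist p q + dist q s
    & forall p q a, 0 <= a <= 1 ->
        exists2 z, dist p z = a * dist p q & dist z q = (1 - a) * dist p q].

Lemma sqrtr_le_of_sqr {R : rcfType} (x y : R) :
  0 <= y -> x <= y ^+ 2 -> Num.sqrt x <= y.
Proof. by move=> y0 xy; rewrite -(ger0_norm y0) -sqrtr_sqr ler_wsqrtr. Qed.

Lemma le_sqrtr_of_sqr {R : rcfType} (x y : R) :
  x ^+ 2 <= y -> `|x| <= Num.sqrt y.
Proof. by move=> xy; rewrite -sqrtr_sqr ler_wsqrtr. Qed.

Lemma sqr_le_of_norm {R : realDomainType} (x u : R) : `|x| <= u -> x ^+ 2 <= u ^+ 2.
Proof.
by move=> xu; rewrite -real_normK ?num_real// ler_sqr ?nnegrE ?(le_trans _ xu).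
Qed.

(** Squaring reduces this to Cauchy-Schwarz, whose defect is a sum of squares by Lagrange's
    identity. *)
Lemma sqrtr_minkowski {R : rcfType} (a b c a' b' c' : R) :
  Num.sqrt ((a + a') ^+ 2 + (b + b') ^+ 2 + (c + c') ^+ 2) <=
  Num.sqrt (a ^+ 2 + b ^+ 2 + c ^+ 2) + Num.sqrt (a' ^+ 2 + b' ^+ 2 + c' ^+ 2).
Proof.
set N := a ^+ 2 + b ^+ 2 + c ^+ 2; set N' := a' ^+ 2 + b' ^+ 2 + c' ^+ 2.
have N0 : 0 <= N by rewrite !addr_ge0 ?sqr_ge0.
have N'0 : 0 <= N' by rewrite !addr_ge0 ?sqr_ge0.
apply: sqrtr_le_of_sqr; first by rewrite addr_ge0 ?sqrtr_ge0.
rewrite [leRHS]sqrrD !sqr_sqrtr// -sqrtrM//.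
have : a * a' + b * b' + c * c' <= Num.sqrt (N * N').
  apply: le_trans (ler_norm _) _; apply: le_sqrtr_of_sqr.
  rewrite -subr_ge0 (_ : _ - _ = (a * b' - b * a') ^+ 2 + (a * c' - c * a') ^+ 2
    + (b * c' - c * b') ^+ 2); last by rewrite /N /N'; ring.
  by rewrite !addr_ge0 ?sqr_ge0.
by rewrite /N /N'; lra.
Qed.

Lemma sqrtr_homogeneous {R : rcfType} (a x y z : R) : 0 <= a ->
  Num.sqrt ((a * x) ^+ 2 + (a * y) ^+ 2 + (a * z) ^+ 2) =
  a * Num.sqrt (x ^+ 2 + y ^+ 2 + z ^+ 2).
Proof.
move=> a0; rewrite !exprMn -!mulrDr sqrtrM ?sqr_ge0//.
by rewrite sqrtr_sqr ger0_norm.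
Qed.

Definition lerp {R : realType} (a : R) (p q : pt R) : pt R :=
  (p.1.1 + a * (q.1.1 - p.1.1), p.1.2 + a * (q.1.2 - p.1.2),
   p.2 + a * (q.2 - p.2)).

Lemma norm_metric_dEucl {R : realType} : norm_metric (@dEucl R).
Proof.
split=> [p q|p q u pq1 pq2 pq3|p q s|p q a /andP[a0 a1]].
- have := sqr_ge0 (p.1.1 - q.1.1); have := sqr_ge0 (p.1.2 - q.1.2).
  have := sqr_ge0 (p.2 - q.2).
  by split; apply: le_sqrtr_of_sqr; lra.
- have u0 : 0 <= u by rewrite (le_trans _ pq1).
  apply: sqrtr_le_of_sqr; first by lra.
  have := sqr_le_of_norm _ _ pq1; have := sqr_le_of_norm _ _ pq2.
  have := sqr_le_of_norm _ _ pq3; have := sqr_ge0 u.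
  by rewrite exprMn; lra.
- rewrite /dEucl (_ : p.1.1 - s.1.1 = (p.1.1 - q.1.1) + (q.1.1 - s.1.1)); last ring.
  rewrite (_ : p.1.2 - s.1.2 = (p.1.2 - q.1.2) + (q.1.2 - s.1.2)); last ring.
  rewrite (_ : p.2 - s.2 = (p.2 - q.2) + (q.2 - s.2)); last ring.
  exact: sqrtr_minkowski.
- exists (lerp a p q); rewrite /dEucl /=.
    rewrite -sqrtr_homogeneous//; congr Num.sqrt; ring.
  rewrite -sqrtr_homogeneous ?subr_ge0//; congr Num.sqrt; ring.
Qed.

Lemma norm_metric_dJM {R : realType} : norm_metric (@dJM R).
Proof.
have sqrt2E (x y : R) :
    Num.sqrt (x ^+ 2 + y ^+ 2) = Num.sqrt (x ^+ 2 + y ^+ 2 + 0 ^+ 2).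
  by rewrite expr0n addr0.
split=> [p q|p q u pq1 pq2 pq3|p q s|p q a /andP[a0 a1]]; rewrite /dJM.
- split; last by rewrite lerDr sqrtr_ge0.
    by rewrite ler_wpDr//; apply: le_sqrtr_of_sqr; rewrite lerDl sqr_ge0.
  by rewrite ler_wpDr//; apply: le_sqrtr_of_sqr; rewrite lerDr sqr_ge0.
- have u0 : 0 <= u by rewrite (le_trans _ pq1).
  rewrite (_ : 3 * u = 2 * u + u); last ring.
  rewrite lerD//; apply: sqrtr_le_of_sqr; first by lra.
  have := sqr_le_of_norm _ _ pq1; have := sqr_le_of_norm _ _ pq2.
  have := sqr_ge0 u.
  by rewrite exprMn; lra.
- rewrite addrACA lerD//; last first.
    by rewrite (_ : p.2 - s.2 = (p.2 - q.2) + (q.2 - s.2)) ?ler_normD//; ring.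
  rewrite (_ : p.1.1 - s.1.1 = (p.1.1 - q.1.1) + (q.1.1 - s.1.1)); last ring.
  rewrite (_ : p.1.2 - s.1.2 = (p.1.2 - q.1.2) + (q.1.2 - s.1.2)); last ring.
  have := sqrtr_minkowski (p.1.1 - q.1.1) (p.1.2 - q.1.2) 0
    (q.1.1 - s.1.1) (q.1.2 - s.1.2) 0.
  by rewrite addr0 -!sqrt2E.
- exists (lerp a p q); rewrite /= [RHS]mulrDr.
    rewrite !sqrt2E -sqrtr_homogeneous// mulr0; congr (Num.sqrt _ + _); first ring.
    by rewrite -[in RHS](ger0_norm a0) -normrM; congr `|_|; ring.
  have b0 : 0 <= 1 - a by rewrite subr_ge0.
  rewrite !sqrt2E -sqrtr_homogeneous// mulr0; congr (Num.sqrt _ + _); first ring.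
  by rewrite -[in RHS](ger0_norm b0) -normrM; congr `|_|; ring.
Qed.

(** * Boxes, their subdivision, and porosity *)

Definition box {R : realType} (c : pt R) (l : R) : set (pt R) :=
  (`[c.1.1, c.1.1 + l[ `*` `[c.1.2, c.1.2 + l[) `*` `[c.2, c.2 + l[.

Definition digit := ('I_32 * 'I_32 * 'I_32)%type.

Definition subcorner {R : realType} (c : pt R) (l : R) (d : digit) : pt R :=
  (c.1.1 + d.1.1%:R * (l / 32), c.1.2 + d.1.2%:R * (l / 32),
   c.2 + d.2%:R * (l / 32)).

Lemma boxP {R : realType} (c : pt R) (l : R) p : box c l p <->
  [/\ c.1.1 <= p.1.1 < c.1.1 + l, c.1.2 <= p.1.2 < c.1.2 + l
    & c.2 <= p.2 < c.2 + l].
Proof. by rewrite /box /= !in_itv /=; split=> [[[]]|[]]. Qed.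

Lemma subinterval_of {R : realType} (c u x : R) (m : nat) :
  0 < u -> c <= x < c + m%:R * u ->
  exists i : 'I_m, c + i%:R * u <= x < c + i%:R * u + u.
Proof.
move=> u0 /andP[cx xc].
have y0 : 0 <= (x - c) / u by rewrite divr_ge0 ?subr_ge0// ltW.
have ym : (x - c) / u < m%:R by rewrite ltr_pdivrMr// ltrBlDl.
have /andP[ly yl] := truncn_itv y0.
have im : (Num.trunc ((x - c) / u) < m)%N by rewrite -(ltr_nat R) (le_lt_trans ly).
exists (Ordinal im) => /=.
move: ly yl; set j := Num.trunc _.
rewrite ler_pdivlMr// ltr_pdivrMr// -natr1 mulrDl mul1r.
by move=> h1 h2; apply/andP; split; lra.
Qed.

Lemma box_subcorner {R : realType} (c : pt R) (l : R) p : 0 < l -> box c l p ->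
  exists d, box (subcorner c l d) (l / 32) p.
Proof.
move=> l0; have u0 : 0 < l / 32 by rewrite divr_gt0.
have lE : l = 32%:R * (l / 32) by field.
rewrite {1}lE => /boxP[h1 h2 h3].
have [i hi] := subinterval_of _ _ _ _ u0 h1.
have [j hj] := subinterval_of _ _ _ _ u0 h2.
have [k hk] := subinterval_of _ _ _ _ u0 h3.
by exists (i, j, k); apply/boxP.
Qed.

Lemma subcorner_box {R : realType} (c : pt R) (l : R) d : 0 < l ->
  box (subcorner c l d) (l / 32) `<=` box c l.
Proof.
move=> l0 p /boxP[/= h1 h2 h3]; apply/boxP.
have u0 : 0 <= l / 32 by rewrite divr_ge0// ltW.
have B (i : 'I_32) : 0 <= i%:R * (l / 32) <= l - l / 32.
  rewrite mulr_ge0//= (_ : l - _ = 31 * (l / 32)); last by field.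
  by rewrite ler_wpM2r// ler_nat -ltnS.
have := B d.1.1; have := B d.1.2; have := B d.2.
by split; lra.
Qed.

(** [W] stands for the chosen points only: the balls need to avoid these, not the whole
    configuration. *)
Definition touching {R : realType} (dist : pt R -> pt R -> R) (W : set (pt R)) :=
  forall p, W p -> exists q r, [/\ dist (origin R) q = r, dist p q = r
    & forall w, W w -> r <= dist w q].

(** Take a subbox well inside the box and far from the origin. If it contains a point of [W], the
    empty ball through that point is large enough to contain a ball of radius [4 * u] whose centre
    is still in the box. The subbox around this centre lies within [3 * u] of it, so it is free of
    [W]. *)
Lemma free_subbox {R : realType} (dist : pt R -> pt R -> R) (W : set (pt R))
    (c : pt R) (l : R) :
  norm_metric dist -> touching dist W -> 0 < l ->
  exists d, W `&` box (subcorner c l d) (l / 32) = set0.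
Proof.
move=> [dist_ge dist_le dist_tri dist_seg] tW l0.
set u := l / 32; have u0 : 0 < u by rewrite divr_gt0.
have lE : l = 32 * u by rewrite /u; field.
(* Of these two subboxes at least one stays away from the origin. *)
have [d dP] : exists d, forall p, box (subcorner c l d) u p ->
    [/\ 8 * u <= `|p.1.1|, c.1.1 + 4 * u <= p.1.1 < c.1.1 + 25 * u,
        c.1.2 + 4 * u <= p.1.2 < c.1.2 + 25 * u
      & c.2 + 4 * u <= p.2 < c.2 + 25 * u].
  have four : (4 < 32)%N by [].
  have twentyfour : (24 < 32)%N by [].
  have [c0|c0] := leP (c.1.1 + 14 * u) 0.
    exists (Ordinal four, Ordinal four, Ordinal four) => p /boxP[/=].
    rewrite -/u => h1 h2 h3; split; try lra.
    by rewrite ler0_norm; lra.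
  exists (Ordinal twentyfour, Ordinal four, Ordinal four) => p /boxP[/=].
  rewrite -/u => h1 h2 h3; split; try lra.
  by rewrite ger0_norm; lra.
have [E|/set0P[p [Wp /dP[p8 p1 p2 p3]]]] :=
  eqVneq (W `&` box (subcorner c l d) u) set0; first by exists d.
have [q [r [Oq pq Wr]]] := tW _ Wp.
(* The first coordinates of [q] and of [p - q] are both at most [r], while that of [p] is at least
   [8 * u]. *)
have r4 : 4 * u <= r.
  have [+ _ _] := dist_ge (origin R) q; have [+ _ _] := dist_ge p q.
  rewrite Oq pq /= sub0r normrN => h1 h2.
  have := ler_normD (p.1.1 - q.1.1) q.1.1; rewrite subrK; lra.
have r0 : 0 < r by lra.
(* The ball of radius 4u around z lies inside the ball of radius r around q. *)
have [z pz zq] : exists2 z, dist p z = 4 * u & dist z q = r - 4 * u.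
  have [|z pz zq] := dist_seg p q (4 * u / r).
    by rewrite divr_ge0 ?ler_pdivrMr ?mul1r//; lra.
  by exists z; rewrite ?pz ?zq pq; field; rewrite gt_eqF.
have [z1 z2 z3] := dist_ge p z.
rewrite pz !ler_norml in z1 z2 z3.
(* The margins [4 * u] and [25 * u] for [p] keep [z] between [0] and [29 * u] from the corner, hence
   inside the box. *)
have [|e /boxP[/= e1 e2 e3]] := box_subcorner c l z l0.
  by apply/boxP; split; lra.
exists e; apply/seteqP; split=> // w [Ww /boxP[/= w1 w2 w3]].
rewrite -/u in e1 e2 e3 w1 w2 w3.
have wz : dist w z <= 3 * u by apply: dist_le; rewrite ler_norml; lra.
have := Wr _ Ww; have := dist_tri w z q; rewrite zq; lra.
Qed.

(** * Covering by finitely many sets of small volume *)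

Lemma measure_bigsetU_le {d : measure_display} {T : ringOfSetsType d}
    {R : realFieldType} (mu : {content set T -> \bar R}) (I : Type) (r : seq I)
    (P : pred I) (F : I -> set T) :
  (forall i, P i -> measurable (F i)) ->
  (mu (\big[setU/set0]_(i <- r | P i) F i) <= \sum_(i <- r | P i) mu (F i))%E.
Proof.
move=> mF; elim: r => [|i r IH]; first by rewrite !big_nil measure0.
rewrite !big_cons; case: ifPn => // Pi.
apply: le_trans (leeD2l _ IH).
by apply: measureU2; [exact: mF|exact: bigsetU_measurable].
Qed.

Lemma measurable_box {R : realType} (c : pt R) (l : R) : measurable (box c l).
Proof. by do 2?apply: measurableX; exact: measurable_itv. Qed.

Lemma leb3_box {R : realType} (c : pt R) (l : R) : 0 < l ->
  leb3 (box c l) = (l ^+ 3)%:E.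
Proof.
move=> l0; rewrite /leb3 /box.
have lI (a : R) : lebesgue_measure (`[a, a + l[%classic : set R) = l%:E.
  by rewrite lebesgue_measure_itv/= lte_fin ltrDl l0 -EFinB addrAC subrr add0r.
have lII (a b : R) : (@lebesgue_measure R \x @lebesgue_measure R)%E
    (`[a, a + l[ `*` `[b, b + l[) = (l * l)%:E.
  apply: etrans (product_measure1E _ _ _ _) _ => //.
  by rewrite [X in (X * _)%E]lI [X in (_ * X)%E]lI.
apply: etrans (product_measure1E _ _ _ _) _ => //; first exact: measurableX.
rewrite [X in (X * _)%E]lII [X in (_ * X)%E]lI -EFinM; congr EFin; ring.
Qed.

Definition shrink {R : realType} : R := 1 - (32 ^+ 3)^-1.

(* The finite family [I] depends only on the depth [n], not on the box: this
   keeps the union bound uniform in [k]. *)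
Lemma touching_cover {R : realType} (n : nat) :
  exists (I : finType) (U : pt R -> R -> I -> set (pt R)),
  forall c l, 0 < l ->
  (forall i, [/\ measurable (U c l i), U c l i `<=` box c l
     & (leb3 (U c l i) <= (shrink ^+ n * l ^+ 3)%:E)%E]) /\
  (forall dist W, norm_metric dist -> touching dist W ->
     exists i, W `&` box c l `<=` U c l i).
Proof.
elim: n => [|n [I [U IH]]].
  exists unit, (fun c l _ => box c l) => c l l0; split=> [_|dist W _ _].
    by split=> //; [exact: measurable_box|rewrite leb3_box// expr0 mul1r].
  by exists tt; exact: subIsetr.
(* An index records the discarded subbox and, for each subbox, a member of the depth-[n] family. *)
exists (digit * {ffun digit -> I})%type.
exists (fun c l (e : digit * {ffun digit -> I}) => \big[setU/set0]_(d : digit | d != e.1)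
  U (subcorner c l d) (l / 32) (e.2 d)) => c l l0.
have u0 : 0 < l / 32 by rewrite divr_gt0.
split=> [[d0 f]|dist W distP tW] /=.
- have mU d : measurable (U (subcorner c l d) (l / 32) (f d)).
    by have [/(_ (f d))[]] := IH (subcorner c l d) _ u0.
  split; first by apply: bigsetU_measurable => d _; exact: mU.
  + apply: (big_ind (fun A => A `<=` box c l)) => [//|A B Ac Bc p [/Ac|/Bc]//|d _].
    apply: subset_trans (subcorner_box c l d l0).
    by have [/(_ (f d))[]] := IH (subcorner c l d) _ u0.
  + rewrite /leb3; apply: le_trans.
      apply: measure_bigsetU_le; first by move=> d _; exact: mU.
    apply: le_trans (lee_sum (g := fun=> (shrink ^+ n * (l / 32) ^+ 3)%:E) _ _) _.
      by move=> d _; have [/(_ (f d))[]] := IH (subcorner c l d) _ u0.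
    (* There remain [32 ^+ 3 - 1] subboxes of volume [(l / 32) ^+ 3], which is exactly one factor
       [shrink]. *)
    have cardE : #|predC1 d0|%:R = 32 ^+ 3 - 1 :> R.
      rewrite cardC1 -subn1 natrB; last by apply/card_gt0P; exists d0.
      by rewrite !card_prod card_ord !natrM; ring.
    rewrite sumEFin lee_fin sumr_const -[leLHS]mulr_natr cardE [shrink ^+ _.+1]exprS /shrink.
    by rewrite le_eqVlt; apply/orP; left; apply/eqP; field.
- have [d0 Wd0] := free_subbox dist W c l distP tW l0.
  have /choice[f fP] d : exists i, W `&` box (subcorner c l d) (l / 32) `<=`
      U (subcorner c l d) (l / 32) i.
    by have [_ /(_ dist W distP tW)] := IH (subcorner c l d) _ u0.
  exists (d0, [ffun d => f d]) => p [Wp /(box_subcorner _ _ _ l0)[d pd]] /=.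
  have dd0 : d != d0.
    by apply/eqP => dE; rewrite dE in pd; have : set0 p by rewrite -Wd0.
  by rewrite (bigD1 d)//= ffunE; left; exact: fP.
Qed.

(** * Tail bound for Poisson counts *)

Lemma expR_ge_partial {R : realType} (x : R) (m : nat) : 0 <= x ->
  \sum_(0 <= i < m) x ^+ i / i`!%:R <= expR x.
Proof.
move=> x0; apply: (nondecreasing_cvgn_le (u_ := series (exp_coeff x))) => //; last first.
  exact: is_cvg_series_exp_coeff.
by apply: nondecreasing_series => i _ _; exact: exp_coeff_ge0.
Qed.

(** Chernoff's trick: for [i >= k] and [b >= 1], the term [x ^+ i] is at most
    [b ^- k * (x * b) ^+ i]. *)
Lemma expR_tail_le {R : realType} (x b : R) (k : nat) : 0 <= x -> 1 <= b ->
  expR x <= \sum_(0 <= i < k) x ^+ i / i`!%:R + b ^- k * expR (x * b).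
Proof.
move=> x0 b1; have b0 : 0 < b by apply: lt_le_trans b1.
apply: limr_le; first exact: is_cvg_series_exp_coeff.
near=> m; have km : (k <= m)%N by near: m; exact: nbhs_infty_ge.
have xb0 : 0 <= x * b by rewrite mulr_ge0// ltW.
rewrite /series /= (big_cat_nat _ km)//= lerD2l.
apply: (@le_trans _ _ (b ^- k * \sum_(0 <= i < m) (x * b) ^+ i / i`!%:R)); last first.
  by rewrite ler_pM2l ?expR_ge_partial// invr_gt0 exprn_gt0.
rewrite [in leRHS](big_cat_nat _ km)//= mulrDr ler_wpDl//.
  rewrite mulr_ge0 ?invr_ge0 ?exprn_ge0 ?(ltW b0)// sumr_ge0// => i _.
  by rewrite divr_ge0// exprn_ge0.
rewrite mulr_sumr; apply: ler_sum_nat => i /andP[ki _].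
rewrite /exp_coeff /= mulrA ler_wpM2r ?invr_ge0// exprMn mulrCA ler_peMr ?exprn_ge0//.
by rewrite mulrC ler_pdivlMr ?exprn_gt0// mul1r ler_weXn2l.
Unshelve. all: by end_near. Qed.

Lemma has_card_ge {T : eqType} (S : set T) (n k : nat) (f : 'I_k -> T) :
  has_card S n -> injective f -> (forall i, S (f i)) -> (k <= n)%N.
Proof.
move=> [s [us [<- SE]]] finj Sf.
rewrite -(card_ord k) cardE -(size_map f); apply: uniq_leq_size.
  by rewrite map_inj_uniq ?enum_uniq.
by move=> _ /mapP[i _ ->]; have := Sf i; rewrite SE.
Qed.

Lemma has_card_inj {T : eqType} (S : set T) (n m : nat) :
  has_card S n -> has_card S m -> n = m.
Proof.
move=> [s [us [<- ->]]] [t [ut [<- st]]].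
have {}st : s =i t by move=> x; apply/idP/idP => xs; have := st;
  move/seteqP => -[h1 h2]; [exact: h1|exact: h2].
by apply/eqP; rewrite eqn_leq !uniq_leq_size// => x; rewrite st.
Qed.

(** The event [G] is that the count is none of [0, ..., k - 1]. As the complement of finitely many
    disjoint count events, it is measurable and its probability is one minus a partial Poisson
    sum. *)
Lemma poisson_count_tail {R : realType} {d : measure_display}
    {Omega : measurableType d} (P : probability Omega R)
    (X : Omega -> set (pt R)) (B : set (pt R)) (k : nat) (b : R) :
  poisson_process_R3 P X -> measurable B -> bounded3 B -> 1 <= b ->
  exists G : set Omega, [/\ measurable G,
    forall w (f : 'I_k -> pt R), injective f -> (forall i, (X w `&` B) (f i)) -> G w
    & (P G <= (b ^- k * expR (fine (leb3 B) * b))%:E)%E].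
Proof.
move=> [_ /(_ B) cP _] mB bB b1.
set x := fine (leb3 B).
have x0 : 0 <= x by apply: fine_ge0; rewrite /leb3; exact: measure_ge0.
have mc n : measurable (count_event X B n) by have [] := cP n mB bB.
exists (~` \big[setU/set0]_(n < k) count_event X B n); split.
- by apply: measurableC; apply: bigsetU_measurable => n _.
- move=> w f finj Bf; rewrite -bigcup_mkord => -[n /= nk wn].
  by have := has_card_ge _ _ _ _ wn finj Bf; rewrite leqNgt nk.
rewrite probability_setC; last by apply: bigsetU_measurable => n _.
rewrite measure_bigsetU//; last first.
  move=> i j _ _ [w [wi wj]]; exact: has_card_inj wi wj.
rewrite (eq_bigr _ (fun (n : 'I_k) _ => (cP n mB bB).2)) -/x.
rewrite sumEFin -EFinB lee_fin.
rewrite -(big_mkord xpredT (fun n => expR (- x) * x ^+ n / n`!%:R)).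
under eq_bigr => n _ do rewrite -mulrA.
rewrite -mulr_sumr lerBlDr.
(* Multiply the tail bound by [expR (- x)], then drop this factor, at most 1, from the remainder
   term. *)
have := expR_tail_le x b k x0 b1.
rewrite -(ler_pM2l (expR_gt0 (- x))) -expRD addNr expR0 mulrDr => /le_trans; apply.
rewrite addrC lerD2r// ler_piMl//; last by rewrite expR_le1 oppr_le0.
by rewrite mulr_ge0 ?expR_ge0// invr_ge0 exprn_ge0// (le_trans _ b1).
Qed.

(** * From the event to the union bound *)

Lemma bounded3_box {R : realType} (c : pt R) (l : R) : bounded3 (box c l).
Proof.
exists (`|c.1.1| + `|c.1.2| + `|c.2| + `|l|) => p /boxP[h1 h2 h3].
have H (a x : R) : a <= x < a + l -> `|x| <= `|a| + `|l|.
  move=> /andP[ax xa]; rewrite -[x](subrK a) addrC (le_trans (ler_normD _ _))//.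
  by rewrite lerD2l ger0_norm ?subr_ge0// (le_trans _ (ler_norm _))// lerBlDl ltW.
have := normr_ge0 c.1.1; have := normr_ge0 c.1.2; have := normr_ge0 c.2.
by have := H _ _ h1; have := H _ _ h2; have := H _ _ h3; split; [|split]; lra.
Qed.

Lemma cube_powR_third {R : realType} (k : nat) : (k%:R `^ (3%:R)^-1) ^+ 3 = k%:R :> R.
Proof. by rewrite -powR_mulrn ?powR_ge0// -powRrM mulVf ?pnatr_eq0// powRr1. Qed.

Lemma expr_lt1_eventually_le {R : realType} (x e : R) :
  0 <= x < 1 -> 0 < e -> exists n, x ^+ n <= e.
Proof.
move=> /andP[x0 x1] e0.
have /cvgr0_norm_le/(_ _ e0)[N _ /(_ N (leqnn N))] :
  (GRing.exp x : R ^nat) @ \oo --> 0 by apply: cvg_expr; rewrite ger0_norm.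
by move=> /= h; exists N; rewrite (le_trans (ler_norm _)).
Qed.

Lemma shrink_itv {R : realType} : 0 <= (shrink : R) < 1.
Proof.
have h : 0 < (32 ^+ 3 : R)^-1 <= 1.
  by rewrite invr_gt0 exprn_gt0//= invf_le1 ?exprn_gt0// exprn_ege1// ler1n.
by rewrite /shrink; lra.
Qed.

(** Each coordinate of a chosen point is at most [2 * r i] in absolute value, passing through the
    centre [Q i]; this gives the box of side [2 * h] centred at the origin. *)
Lemma event_E_touching {R : realType} (Omega : Type) (X : Omega -> set (pt R))
    (dist : pt R -> pt R -> R) (A : R) (k : nat) (w : Omega) :
  norm_metric dist -> event_E X dist A k w ->
  exists f : 'I_k -> pt R, [/\ injective f, forall i, X w (f i),
    touching dist (range f)
    & let h := 2 * A * (k%:R `^ (3%:R)^-1) in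
      range f `<=` box (- h, - h, - h) (2 * h)].
Proof.
move=> [dist_ge _ _ _] [f [finj [Xf [Q [r [rA [rd rmin]]]]]]]; exists f; split=> //.
  move=> _ [i _ <-]; exists (Q i), (r i); have [? ?] := rd i.
  by split=> // _ [j _ <-].
set h := 2 * A * _ => /= _ [i _ <-]; apply/boxP.
have [Oq pq] := rd i; have [_ rAi] := rA i.
have [+ + +] := dist_ge (origin R) (Q i); have [+ + +] := dist_ge (f i) (Q i).
rewrite Oq pq /= !sub0r !normrN !ler_norml => a1 a2 a3 b1 b2 b3.
have h2 : 2 * r i < h by rewrite /h -mulrA ltr_pM2l.
by clearbody h; clear - a1 a2 a3 b1 b2 b3 h2; split; lra.
Qed.

Theorem theorem4p1 (R : realType) (d : measure_display)
  (Omega : measurableType d) (P : probability Omega R)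
  (X : Omega -> set (pt R)) (dist : pt R -> pt R -> R) (A C : R) :
  poisson_process_R3 P X ->
  (dist = @dEucl R \/ dist = @dJM R) ->
  0 < A -> 0 < C ->
  exists F : nat -> set Omega,
    (forall k, measurable (F k) /\ event_E X dist A k `<=` F k) /\
    (fun k : nat => fine (P (F k)) * expR (C * k%:R)) @ \oo --> 0.
Proof.
move=> PX distE A0 C0.
have distP : norm_metric dist.
  by case: distE => ->; [exact: norm_metric_dEucl|exact: norm_metric_dJM].
(* With mean at most [k / b], the Chernoff bound is [b ^- k * expR k = expR (- (C + 1) * k)]; the
   spare unit over [C] makes the final product decay. *)
set b := expR (C + 2).
have b0 : 0 < b by exact: expR_gt0.
have b1 : 1 <= b by rewrite -[leLHS]expR0 ler_expR; lra.
have V0 : 0 < (4 * A) ^+ 3 * b by rewrite mulr_gt0// exprn_gt0// mulr_gt0.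
have [n nV] : exists n, shrink ^+ n * ((4 * A) ^+ 3 * b) <= 1.
  have [|n nP] := expr_lt1_eventually_le _ ((4 * A) ^+ 3 * b)^-1 (@shrink_itv R).
    by rewrite invr_gt0.
  by exists n; rewrite -ler_pdivlMr// div1r.
(* The depth [n] depends only on [A] and [C], so [I] is fixed before [k]. *)
have [I [U UP]] := @touching_cover R n.
have bk k : b ^- k * expR k%:R = expR (- (C + 1) * k%:R).
  by rewrite /b -expRM_natr -expRN -expRD; congr expR; ring.
have /choice[F FP] k : exists F : set Omega,
    [/\ measurable F, event_E X dist A k `<=` F
      & (P F <= ((#|I|.+1)%:R * expR (- (C + 1) * k%:R))%:E)%E].
  (* For [k = 0] the box degenerates, so the whole space is taken; the successor in [#|I|.+1] keeps
     the bound at least 1. *)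
  have [->|k0] := posnP k.
    exists setT; split=> //.
    by rewrite probability_setT mulr0 expR0 mulr1 lee_fin ler1n.
  set h := 2 * A * (k%:R `^ (3%:R)^-1).
  have h0 : 0 < 2 * h by rewrite /h !mulr_gt0// powR_gt0// ltr0n.
  have hE : (2 * h) ^+ 3 = (4 * A) ^+ 3 * k%:R.
    by rewrite -(cube_powR_third k) /h; ring.
  have [UI Ucover] := UP (- h, - h, - h) (2 * h) h0.
  have /choice[G GP] i : exists G : set Omega, [/\ measurable G,
      forall w (f : 'I_k -> pt R), injective f ->
        (forall j, (X w `&` U (- h, - h, - h) (2 * h) i) (f j)) -> G w
      & (P G <= (expR (- (C + 1) * k%:R))%:E)%E].
    have [mU Ubox Uvol] := UI i.
    have bU : bounded3 (U (- h, - h, - h) (2 * h) i).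
      have [M MP] := bounded3_box (- h, - h, - h) (2 * h).
      by exists M => p /Ubox/MP.
    have [G [mG GX PG]] := poisson_count_tail P X _ k b PX mU bU b1.
    exists G; split=> //; apply: le_trans PG _; rewrite lee_fin -bk.
    rewrite ler_pM2l ?invr_gt0 ?exprn_gt0// ler_expR.
    apply: (@le_trans _ _ (shrink ^+ n * (2 * h) ^+ 3 * b)).
      rewrite ler_pM2r// -lee_fin fineK//.
      rewrite ge0_fin_numE; first by rewrite (le_lt_trans Uvol)// ltry.
      by rewrite /leb3; exact: measure_ge0.
    rewrite hE.
    have := ler_wpM2r (ler0n R k) nV; rewrite mul1r; apply: le_trans.
    by rewrite le_eqVlt; apply/orP; left; apply/eqP; ring.
  (* On the event, some [U i] contains all [k] chosen points, which forces [G i]. *)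
  exists (\big[setU/set0]_(i : I) G i); split.
  - by apply: bigsetU_measurable => i _; have [] := GP i.
  - move=> w /(event_E_touching _ _ _ _ _ _ distP)[f [finj Xf tf fbox]].
    have [i iP] := Ucover dist _ distP tf.
    rewrite (bigD1 i)//=; left; have [_ Gi _] := GP i; apply: (Gi w f finj) => j.
    by split=> //; apply: iP; split; [exists j|apply: fbox; exists j].
  apply: le_trans.
    by apply: measure_bigsetU_le => i _; have [] := GP i.
  apply: le_trans (lee_sum (g := fun=> (expR (- (C + 1) * k%:R))%:E) _ _) _.
    by move=> i _; have [] := GP i.
  rewrite sumEFin lee_fin sumr_const -[leLHS]mulr_natl ler_wpM2r ?expR_ge0//.
  by rewrite ler_nat leqnSn.
exists F; split=> [k|]; first by have [] := FP k.
(* Multiplying by [expR (C * k)] leaves the geometric majorant [#|I|.+1 * expR (- k)]. *)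
apply: (@squeeze_cvgr _ _ _ _ (cst 0) (geometric (#|I|.+1)%:R (expR (-1)))).
- near=> k => /=; have [mF _ PF] := FP k.
  rewrite mulr_ge0 ?expR_ge0 ?fine_ge0//= -expRM_natr.
  have -> : -1 * k%:R = - (C + 1) * k%:R + C * k%:R by ring.
  rewrite expRD mulrA ler_pM2r ?expR_gt0// -lee_fin fineK//.
  exact: fin_num_measure.
- exact: cvg_cst.
- by apply: cvg_geometric; rewrite ger0_norm ?expR_ge0// expR_lt1; lra.
Unshelve. all: by end_near. Qed.
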